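(* Let $R$ be a finite Frobenius ring, let $n$ be a positive integer, and let $C\leq{}_RR^n$ be a modular (left linear) two-weight code of index $r$ with nonzero homogeneous weights $w_1<w_2$, such that $C_0=\{\mathbf{c}\in C;\ \mathrm{w}_{\mathrm{hom}}(\mathbf{c})=0\}=\{\mathbf{0}\}$. Let $b_1$ be the number of codewords of $C$ of homogeneous weight $w_1$. Then the dual $C'\leq R^{b_1}_R$ of the two-weight code $C$ is also a (modular) two-weight code, with $C'_0=\{\mathbf{d}\in C';\ \mathrm{w}_{\mathrm{hom}}(\mathbf{d})=0\}=\{\mathbf{0}\}$ and with nonzero weights $$w_1'=\frac{(w_2-n-r)|C|}{w_2-w_1}=\frac{b_1w_1}{n},\qquad w_2'=\frac{(w_2-n)|C|}{w_2-w_1}.$$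
   Context: Rings are associative with $1$; $R^\times$ is the group of units. A finite ring $R$ is a Frobenius ring if there is a character $\chi\in\mathrm{Hom}_{\mathbb{Z}}(R,\mathbb{C}^\times)$ of $(R,+)$ whose kernel contains no nonzero left (or right) ideal of $R$. The (normalized) homogeneous weight $\mathrm{w}_{\mathrm{hom}}\colon R\to\mathbb{C}$ is $\mathrm{w}_{\mathrm{hom}}(x)=1-\frac{1}{|R^\times|}\sum_{u\in R^\times}\chi(ux)$ (independent of the choice of such $\chi$; its values are real and nonnegative). It is extended to $R^n$ by $\mathrm{w}_{\mathrm{hom}}(\mathbf{x})=\sum_{j=1}^n\mathrm{w}_{\mathrm{hom}}(x_j)$. A left (right) linear code is a left (right) submodule of $R^n$. A two-weight code is a linear code on which $\mathrm{w}_{\mathrm{hom}}$ takes exactly two nonzero values. Modular codes: let $C\leq{}_RR^n$ have no all-zero coordinate (for each $j$ some codeword has nonzero $j$-th entry), and write $C=\{\mathbf{x}\mathbf{G};\mathbf{x}\in R^k\}$ with $\mathbf{G}=(\mathbf{g}_1|\dots|\mathbf{g}_n)\in R^{k\times n}$. For a nonzero cyclic right submodule $\mathbf{g}R$ of $R^k_R$ (a ''point'') let $\alpha_C(\mathbf{g}R)=|\{j;\ \mathbf{g}_jR=\mathbf{g}R\}|$. The code $C$ is modular of index $r\in\mathbb{Q}$ if for every point $\mathbf{g}R$ either $\alpha_C(\mathbf{g}R)=0$ or $\alpha_C(\mathbf{g}R)=r\,|\mathbf{g}R^\times|$. (This does not depend on the choice of $k$ and $\mathbf{G}$.) Modularity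 of right linear codes is defined analogously with left and right interchanged (a right linear code is the right column space of a matrix, and one counts its rows by the cyclic left submodules they generate). Dual of a two-weight code: let $\mathbf{M}_1\in R^{b_1\times n}$ be a matrix whose rows are the codewords of $C$ of weight $w_1$ in some order. The dual $C'$ of $C$ is the right linear code $C'=\{\mathbf{M}_1\mathbf{y};\ \mathbf{y}\in R^n\}\leq R^{b_1}_R$ ($\mathbf{y}$ written as a column) generated by the columns of $\mathbf{M}_1$. *)

(* Defs.v *)
From HB Require Import structures.
From mathcomp Require Import all_boot all_order all_algebra.

Set Implicit Arguments.
Unset Strict Implicit.
Unset Printing Implicit Defensive.

Import Order.TTheory GRing.Theory Num.Theory.
Local Open Scope ring_scope.

Section FrobeniusRings.
Variables (F : numClosedFieldType) (R : finUnitRingType).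
Implicit Types (chi : R -> F) (I : {set R}).

Definition left_ideal I : Prop :=
  [/\ 0 \in I, {in I &, forall x y, x + y \in I}
    & forall a, {in I, forall x, a * x \in I}].

Definition right_ideal I : Prop :=
  [/\ 0 \in I, {in I &, forall x y, x + y \in I}
    & forall a, {in I, forall x, x * a \in I}].

Definition additive_character chi : Prop :=
  (forall x, chi x != 0) /\ (forall x y, chi (x + y) = chi x * chi y).

Definition char_ker chi : {set R} := [set x | chi x == 1].

(* The two alternatives are equivalent; R is a Frobenius ring iff it has such
   a character. *)
Definition frobenius_character chi : Prop :=
  additive_character chi /\
  ((forall I, left_ideal I -> I \subset char_ker chi -> I = [set 0]) \/
   (forall I, right_ideal I -> I \subset char_ker chi -> I = [set 0])).

Definition units_of : {set R} := [set u | u \is a GRing.unit].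

(* Independent of the choice of the Frobenius character chi. *)
Definition whom chi (x : R) : F :=
  1 - #|units_of|%:R^-1 * \sum_(u in units_of) chi (u * x).

(* Used for rows (m = 1, left codes) and for columns (n = 1, right codes). *)
Definition whomv chi m n (x : 'M[R]_(m, n)) : F :=
  \sum_i \sum_j whom chi (x i j).

(* w1 and w2 are exactly the nonzero weights occurring in C. *)
Definition two_weights chi m n (C : {set 'M[R]_(m, n)}) (w1 w2 : F) : Prop :=
  [/\ [/\ w1 != 0, w2 != 0 & w1 != w2],
      exists2 c, c \in C & whomv chi c = w1,
      exists2 c, c \in C & whomv chi c = w2
    & forall c, c \in C ->
        [\/ whomv chi c = 0, whomv chi c = w1 | whomv chi c = w2]].

End FrobeniusRings.

Section Codes.
Variable R : finUnitRingType.

(* Right scalar multiplication: the lmodType structure on matrices is the left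
   one, and R need not be commutative. *)
Definition rscale m n (g : 'M[R]_(m, n)) (a : R) : 'M[R]_(m, n) :=
  \matrix_(i, j) (g i j * a).

Definition left_linear n (C : {set 'rV[R]_n}) : Prop :=
  [/\ 0 \in C, {in C &, forall x y, x + y \in C}
    & forall a, {in C, forall x, a *: x \in C}].

Definition right_linear m (D : {set 'cV[R]_m}) : Prop :=
  [/\ 0 \in D, {in D &, forall x y, x + y \in D}
    & forall a, {in D, forall x, rscale x a \in D}].

Definition left_row_space k n (G : 'M[R]_(k, n)) : {set 'rV[R]_n} :=
  [set x *m G | x : 'rV[R]_k].

Definition right_col_space m k (G : 'M[R]_(m, k)) : {set 'cV[R]_m} :=
  [set G *m y | y : 'cV[R]_k].

Definition right_cyclic k (g : 'cV[R]_k) : {set 'cV[R]_k} :=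
  [set rscale g a | a : R].

Definition left_cyclic k (g : 'rV[R]_k) : {set 'rV[R]_k} :=
  [set a *: g | a : R].

Definition right_orbit k (g : 'cV[R]_k) : {set 'cV[R]_k} :=
  [set rscale g u | u in units_of R].

Definition left_orbit k (g : 'rV[R]_k) : {set 'rV[R]_k} :=
  [set u *: g | u in units_of R].

Definition col_mult k n (G : 'M[R]_(k, n)) (g : 'cV[R]_k) : nat :=
  #|[set j | right_cyclic (col j G) == right_cyclic g]|.

Definition row_mult m k (G : 'M[R]_(m, k)) (g : 'rV[R]_k) : nat :=
  #|[set i | left_cyclic (row i G) == left_cyclic g]|.

(* In left_modular and right_modular a point is given by a generator g != 0.
   The multiplicity condition does not depend on the choice of k and G, and a
   suitable G always exists for a linear code. *)
Definition left_modular n (C : {set 'rV[R]_n}) (r : rat) : Prop :=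
  (forall j, exists2 c : 'rV[R]_n, c \in C & c 0 j != 0) /\
  exists k (G : 'M[R]_(k, n)),
    C = left_row_space G /\
    forall g : 'cV[R]_k, g != 0 ->
      col_mult G g = 0%N \/
      (col_mult G g)%:R = r * #|right_orbit g|%:R :> rat.

Definition right_modular m (D : {set 'cV[R]_m}) (r : rat) : Prop :=
  (forall i, exists2 d : 'cV[R]_m, d \in D & d i 0 != 0) /\
  exists k (G : 'M[R]_(m, k)),
    D = right_col_space G /\
    forall g : 'rV[R]_k, g != 0 ->
      row_mult G g = 0%N \/
      (row_mult G g)%:R = r * #|left_orbit g|%:R :> rat.

(* The rows of M are the elements of A, each exactly once, in some order. *)
Definition row_listing b n (M : 'M[R]_(b, n)) (A : {set 'rV[R]_n}) : Prop :=
  perm_eq [seq row i M | i <- enum 'I_b] (enum A).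

End Codes.

(* Main.v *)
Require Import Defs.
From HB Require Import structures.
From mathcomp Require Import all_boot all_order all_algebra.
From mathcomp Require Import reals complex.
From mathcomp Require Import ring.

Set Implicit Arguments.
Unset Strict Implicit.
Unset Printing Implicit Defensive.

Import Order.TTheory GRing.Theory Num.Theory.
Local Open Scope ring_scope.

(* Write C = {x G} and let Omega be the set of generators of the points
   occurring among the columns of G.  Modularity turns the weight into a sum of
   characters, w(x G) = n - r sum_(h in Omega) chi(x h), with n = r |Omega|.
   On the other hand w = w2 - w2 1_0 - (w2 - w1) 1_X1 on C, where X1 is the set
   of codewords of weight w1.  Comparing the Fourier transforms of these two
   expressions gives w(M1 y) = b1 - sum_(c in X1) chi(c y) as a function of
   G y only: it is 0, w1' or w2' according to whether G y is 0, lies in Omega,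
   or neither.  If the last case did not occur, w would be constant on
   C \ {0}.  Summing w(M1 y) over the unit vectors y gives n w1' = b1 w1, and
   the rows of M1 show that C' is modular of index 1. *)

(** * Generators of cyclic modules *)

(** A left inverse makes left multiplication by [x] injective, hence surjective because [R] is
    finite; the resulting right inverse must equal [y]. *)
Lemma finUnitRing_linv_unit (R : finUnitRingType) (x y : R) :
  y * x = 1 -> x \is a GRing.unit.
Proof.
move=> yx; have inj_x : injective ( *%R x).
  by move=> a b /(congr1 ( *%R y)); rewrite !mulrA yx !mul1r.
have [x' _ xx'] := injF_bij inj_x.
by apply/unitrP; exists y; split=> //; rewrite -[x in LHS]mulr1 -{2}yx;
  have := xx' 1; move: (x' 1) => z xz; rewrite yx mulr1 -[y]mulr1 -xz mulrA yx mul1r.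
Qed.

(* The number of x in R with x *: g = v and R x = J is the same for all
   generators v of R g: by Moebius inversion this reduces to counting the
   solutions of x *: g = v in a left ideal J, which are either absent (for all
   generators v at once) or form a coset of the solutions of x *: g = 0. For
   J = R and v = g there is the solution x = 1. *)
Lemma cyclic_generators_associated (R : finUnitRingType) (V : lmodType R)
    (g h : V) (a b : R) :
  a *: g = h -> b *: h = g -> exists2 u : R, u \is a GRing.unit & u *: g = h.
Proof.
move=> ag bh; pose M (x : R) := [set y * x | y : R].
have M_P x y : reflect (exists z, y = z * x) (y \in M x).
  by apply: (iffP imsetP) => [[z _ ->]|[z ->]]; exists z.
have M_id x : x \in M x by apply/M_P; exists 1; rewrite mul1r.
pose E (v : V) (J : {set R}) := #|[set x | (x *: g == v) && (M x == J)]|.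
pose N (v : V) (J : {set R}) := #|[set x | (x *: g == v) && (M x \subset J)]|.
have NE v J : N v J = (\sum_(J' : {set R} | J' \subset J) E v J')%N.
  rewrite /N -sum1_card (partition_big M (fun J' : {set R} => J' \subset J)) /=;
    last by move=> x; rewrite inE => /andP[].
  apply: eq_bigr => J' sJ'; rewrite /E -sum1_card; apply: eq_bigl => x.
  by rewrite !inE -andbA; congr andb; case: eqP => [->|]; rewrite ?sJ' ?andbF.
have N_principal x0 : N h (M x0) = N g (M x0).
  have sM x : (M x \subset M x0) = (x \in M x0).
    apply/subsetP/idP => [/(_ x (M_id x))//|/M_P[z ->] y /M_P[t ->]].
    by apply/M_P; exists (t * z); rewrite mulrA.
  suff le v w c : c *: v = w -> (exists d, d *: w = v) ->
      (N w (M x0) <= N v (M x0))%N.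
    by apply/eqP; rewrite eqn_leq (le g h a) ?(le h g b) //; [exists a | exists b].
  move=> cv [d dw]; rewrite /N.
  case: (pickP [pred x | (x *: g == w) && (x \in M x0)]) => [x1|none].
    case/andP=> /eqP x1w /M_P[z1 x1E].
    (* Given one solution [x1] for [w], translation by [d * x1 - x1] stays in the left ideal and
       carries solutions for [w] to solutions for [v], since [w + d *: w - w = v]. *)
    rewrite -(card_imset _ (addIr (d * x1 - x1))) subset_leq_card //.
    apply/subsetP => _ /imsetP[y + ->]; rewrite !inE !sM.
    case/andP=> /eqP yw /M_P[z yE]; apply/andP; split.
      by rewrite scalerDl scalerBl -scalerA yw x1w dw addrC subrK.
    apply/M_P; exists (z + (d * z1 - z1)).
    by rewrite yE x1E mulrDl mulrBl mulrA.
  rewrite (_ : [set x | _ & _] = set0) ?cards0 //; apply/setP => x.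
  by rewrite !inE sM; have /= := none x.
have EE J : E h J = E g J.
  (* Moebius inversion as strong induction on [#|J|]: in [N h J = N g J] the terms of proper subsets
     agree and cancel. If [J] is not principal, both counts are 0. *)
  have [n leJn] := ubnP #|J|; elim: n J leJn => // n IHn J leJn.
  case: (pickP [pred x | M x == J]) => [x0 /eqP MJ|none]; last first.
    by congr #|pred_of_set _|; apply/setP => x;
      rewrite !inE (none x : (M x == J) = false) !andbF.
  have := N_principal x0; rewrite MJ !NE (bigD1 J) //= [RHS](bigD1 J) //=.
  rewrite (eq_bigr (E g)); first by move/addIn.
  move=> J' /andP[sJ' nJ']; apply: IHn.
  by rewrite -ltnS (leq_trans _ leJn) // ltnS proper_card // properEneq nJ'.
have: (0 < E h setT)%N.
  rewrite EE card_gt0; apply/set0Pn; exists 1; rewrite inE scale1r eqxx /=.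
  by apply/eqP/setP => x; rewrite inE; apply/M_P; exists x; rewrite mulr1.
rewrite card_gt0 => /set0Pn[u]; rewrite inE => /andP[/eqP ugh /eqP Mu].
(* [R u = R] provides a left inverse of [u], which is enough in a finite ring. *)
have /M_P[y yu] : 1 \in M u by rewrite Mu inE.
by exists u => //; apply: (@finUnitRing_linv_unit _ _ y).
Qed.

Lemma left_cyclic_eqE (R : finUnitRingType) k (g h : 'rV[R]_k) :
  (left_cyclic h == left_cyclic g) = (h \in left_orbit g).
Proof.
apply/eqP/imsetP => [eq_gh|[u]].
  have /imsetP[a _ ag] : h \in left_cyclic g.
    by rewrite -eq_gh; apply/imsetP; exists 1; rewrite ?scale1r.
  have /imsetP[b _ bh] : g \in left_cyclic h.
    by rewrite eq_gh; apply/imsetP; exists 1; rewrite ?scale1r.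
  have [u uU ug] := cyclic_generators_associated (esym ag) (esym bh).
  by exists u; rewrite ?inE.
rewrite inE => uU ->; apply/setP => v; apply/imsetP/imsetP => -[a _ ->].
  by exists (a * u); rewrite ?scalerA.
by exists (a / u); rewrite ?scalerA ?divrK.
Qed.

Lemma rscale1 (R : finUnitRingType) m n (g : 'M[R]_(m, n)) : rscale g 1 = g.
Proof. by apply/matrixP => i j; rewrite !mxE mulr1. Qed.

Lemma rscaleA (R : finUnitRingType) m n (g : 'M[R]_(m, n)) a b :
  rscale (rscale g a) b = rscale g (a * b).
Proof. by apply/matrixP => i j; rewrite !mxE mulrA. Qed.

Lemma mulmx_rscale (R : finUnitRingType) m n p (A : 'M[R]_(m, n))
    (B : 'M[R]_(n, p)) a :
  A *m rscale B a = rscale (A *m B) a.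
Proof.
by apply/matrixP => i j; rewrite !mxE mulr_suml; apply: eq_bigr => l _;
  rewrite !mxE mulrA.
Qed.

(** With the converse ring known to be finite, right scaling over [R] becomes left scaling over
    [R^c], and the result on left modules transfers to columns. *)
HB.instance Definition _ (R : finUnitRingType) := Finite.copy R^c R.

Lemma right_cyclic_eqE (R : finUnitRingType) k (g h : 'cV[R]_k) :
  (right_cyclic h == right_cyclic g) = (h \in right_orbit g).
Proof.
apply/eqP/imsetP => [eq_gh|[u]].
  have /imsetP[a _ ag] : h \in right_cyclic g.
    by rewrite -eq_gh; apply/imsetP; exists 1; rewrite ?rscale1.
  have /imsetP[b _ bh] : g \in right_cyclic h.
    by rewrite eq_gh; apply/imsetP; exists 1; rewrite ?rscale1.
  have rE (v : 'cV[R]_k) c : rscale v c = (c : R^c) *: (v : 'cV[R^c]_k).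
    by apply/matrixP => i j; rewrite !mxE.
  have [u uU ug] :
      exists2 u : R^c, u \is a GRing.unit & u *: (g : 'cV[R^c]_k) = h.
    have := @cyclic_generators_associated R^c 'cV[R^c]_k g h a b.
    by apply; [rewrite -(rE g a) | rewrite -(rE h b)].
  by exists u; rewrite ?inE // rE.
rewrite inE => uU ->; apply/setP => v; apply/imsetP/imsetP => -[a _ ->].
  by exists (u * a); rewrite ?rscaleA.
by exists (u^-1 * a); rewrite ?rscaleA ?mulKVr // mulrA mulrV ?mul1r.
Qed.

(** * Character sums *)

(** Translation by an [a] in [A] with [f a != 1] permutes the finite set [A], so the sum equals
    [f a] times itself. *)
Lemma char_sum_in_eq0 (F : fieldType) (T : finZmodType) (A : {set T}) (f : T -> F) :
    {morph f : x y / x + y >-> x * y} -> {in A &, forall x y, x + y \in A} ->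
    (exists2 x, x \in A & f x != 1) ->
  \sum_(x in A) f x = 0.
Proof.
move=> fD AD [a aA fa1].
apply/eqP; rewrite -(mulrI_eq0 _ (mulfI (_ : 1 - f a != 0)));
  last by rewrite subr_eq0 eq_sym.
have imA : +%R a @: A = A.
  apply/eqP; rewrite eqEcard card_imset ?leqnn ?andbT; last exact: addrI.
  by apply/subsetP => _ /imsetP[x xA ->]; apply: AD.
rewrite mulrBl mul1r mulr_sumr subr_eq0 -[in X in X == _]imA big_imset /=.
  by apply/eqP/eq_bigr => x _; rewrite fD.
by move=> x y _ _ /addrI.
Qed.

Lemma char_sum_eq0 (F : fieldType) (T : finZmodType) (f : T -> F) :
  {morph f : x y / x + y >-> x * y} -> (exists x, f x != 1) ->
  \sum_x f x = 0.
Proof.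
move=> fD [a fa1]; rewrite -(eq_bigl _ _ (in_setT (T := T))).
apply: (char_sum_in_eq0 fD) => [x y _ _|]; first by rewrite inE.
by exists a; rewrite ?inE.
Qed.

(** * Nondegenerate multiplicative pairings on a finite abelian group *)

Section Pairing.
Variables (F : numFieldType) (T : finZmodType) (B : T -> T -> F).
Hypothesis B_neq0 : forall x y, B x y != 0.
Hypothesis BDl : forall x y z, B (x + y) z = B x z * B y z.
Hypothesis BDr : forall x y z, B x (y + z) = B x y * B x z.
Hypothesis B_nondeg : forall y, y != 0 -> exists x, B x y != 1.

Let B0l y : B 0 y = 1.
Proof. by apply/(mulfI (B_neq0 0 y)); rewrite -BDl addr0 mulr1. Qed.

Let B0r x : B x 0 = 1.
Proof. by apply/(mulfI (B_neq0 x 0)); rewrite -BDr addr0 mulr1. Qed.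

Lemma pairing_suml y : \sum_x B x y = #|T|%:R * (y == 0)%:R.
Proof.
have [->|y0] := eqVneq; last first.
  rewrite mulr0; apply: char_sum_eq0 => [x z|]; first exact: BDl.
  exact: B_nondeg.
under eq_bigr do rewrite B0r.
by rewrite sumr_const mulr1.
Qed.

(* Summing B over T x T in both orders: the number of z with B z = 1 is 1. *)
Lemma pairing_nondegr x : x != 0 -> exists y, B x y != 1.
Proof.
move=> x0; apply/existsP; apply: contraT => /existsPn xB.
have T0 : #|T|%:R != 0 :> F by rewrite pnatr_eq0 -lt0n; apply/card_gt0P; exists 0.
have: \sum_y \sum_z B z y = #|T|%:R :> F.
  under eq_bigr do rewrite pairing_suml.
  rewrite -mulr_sumr (bigD1 0) //= eqxx big1 ?addr0 ?mulr1 //.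
  by move=> y /negPf->.
rewrite exchange_big /=.
have sumE z : \sum_y B z y = #|T|%:R * [forall y, B z y == 1]%:R.
  case: (boolP [forall y, _]) => [/forallP z1|/forallPn z1].
    under eq_bigr do rewrite (eqP (z1 _)).
    by rewrite sumr_const mulr1.
  by rewrite mulr0; apply: char_sum_eq0 => [? ?|//]; rewrite BDr.
under eq_bigr do rewrite sumE.
rewrite -mulr_sumr -[RHS]mulr1 => /(mulfI T0).
have t1 z : (forall y, B z y = 1) -> [forall y, B z y == 1].
  by move=> z1; apply/forallP => y; rewrite z1.
rewrite (bigD1 0) //= (bigD1 x) //= !t1 //; last first.
  by move=> y; apply/eqP/negPn.
move/eqP; rewrite -subr_eq0 addrAC subrr add0r addr_eq0 -natr_sum -subr_eq0.
by rewrite opprK -natrD pnatr_eq0.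
Qed.

(** If no [B z] equals [psi], then [B z x * psi (- x)] is a nontrivial character of [x] for each [z]
    and sums to 0. Summing over [z] first leaves only [x = 0], which contributes [#|T|], a
    contradiction. *)
Lemma pairing_repr (psi : T -> F) :
  {morph psi : x y / x + y >-> x * y} -> (forall x, psi x != 0) ->
  exists z, forall x, B z x = psi x.
Proof.
move=> psiD psi0; suff /existsP[z /forallP zP] : [exists z, forall x, B z x == psi x].
  by exists z => x; apply/eqP.
apply: contraT => /existsPn noz.
have psi_0 : psi 0 = 1 by apply/(mulfI (psi0 0)); rewrite -psiD addr0 mulr1.
have: \sum_z \sum_x B z x * psi (- x) = 0.
  apply: big1 => z _; apply: char_sum_eq0 => [x y|].
    by rewrite BDr opprD psiD mulrACA.
  have /forallPn[x xP] := noz z; exists x; apply: contra xP => /eqP xP.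
  by apply/eqP/(mulIf (psi0 (- x))); rewrite xP -psiD subrr psi_0.
rewrite exchange_big (bigD1 0) //= oppr0 psi_0.
under eq_bigr do rewrite B0r mulr1.
rewrite [X in _ + X]big1 ?addr0; last first.
  by move=> x x0; rewrite -mulr_suml pairing_suml (negPf x0) mulr0 mul0r.
rewrite sumr_const => /eqP; rewrite pnatr_eq0 => /eqP T0.
by have: (0 < #|T|)%N by [apply/card_gt0P; exists 0]; rewrite T0.
Qed.

End Pairing.

(** * Frobenius characters and the homogeneous weight *)

Section FrobeniusCharacter.
Variables (F : numClosedFieldType) (R : finUnitRingType) (chi : R -> F).
Hypothesis chi_frob : frobenius_character chi.

Lemma frob_neq0 x : chi x != 0.
Proof. by case: chi_frob => -[]. Qed.

Lemma frobD : {morph chi : x y / x + y >-> x * y}.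
Proof. by case: chi_frob => -[]. Qed.

Lemma frob0 : chi 0 = 1.
Proof. by apply/(mulfI (frob_neq0 0)); rewrite -frobD addr0 mulr1. Qed.

Lemma frobN x : chi (- x) = (chi x)^-1.
Proof. by apply/(mulfI (frob_neq0 x)); rewrite -frobD subrr frob0 divff ?frob_neq0. Qed.

Lemma frob_norm x : `|chi x| = 1.
Proof.
have chiX n : chi (x *+ n) = chi x ^+ n.
  by elim: n => [|n IHn]; rewrite ?frob0 // mulrS exprS frobD IHn.
have T0 : (0 < #|R|)%N by apply/card_gt0P; exists 0.
apply: (pexpIrn T0); rewrite ?nnegrE ?ler01 // -normrX -chiX expr1n.
suff -> : x *+ #|R| = 0 by rewrite frob0 normr1.
(* Adding [x] permutes [R], so the sum of all elements is unchanged by [x *+ #|R|]. Hence [chi x] is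
   a root of unity. *)
apply: (addrI (\sum_(y : R) y)); rewrite addr0 [RHS](reindex_inj (addIr x)).
by rewrite big_split sumr_const.
Qed.

(** A [y] with [chi (x * y) = 1] for all [x] generates a left ideal inside the kernel, and
    symmetrically on the right. Each alternative of [frobenius_character] thus gives nondegeneracy
    on one side, and [pairing_nondegr] supplies the other. *)
Lemma frob_nondeg :
  (forall y, y != 0 -> exists x, chi (x * y) != 1) /\
  (forall x, x != 0 -> exists y, chi (x * y) != 1).
Proof.
have [_ [nol|nor]] := chi_frob.
  have nd y : y != 0 -> exists x, chi (x * y) != 1.
    move=> y0; apply/existsP; apply: contraNT y0 => /existsPn yP.
    suff /setP/(_ y) : [set x * y | x : R] = [set 0].
      by rewrite !inE => <-; apply/imsetP; exists 1; rewrite ?mul1r.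
    apply: nol; last first.
      by apply/subsetP => _ /imsetP[x _ ->]; rewrite inE; apply/negPn.
    split=> [|_ _ /imsetP[x _ ->] /imsetP[z _ ->]|a _ /imsetP[x _ ->]].
    - by apply/imsetP; exists 0; rewrite ?mul0r.
    - by apply/imsetP; exists (x + z); rewrite ?mulrDl.
    by apply/imsetP; exists (a * x); rewrite ?mulrA.
  split=> // x; apply: (@pairing_nondegr _ _ (fun x y => chi (x * y))) => //= *.
  - exact: frob_neq0.
  - by rewrite mulrDl frobD.
  - by rewrite mulrDr frobD.
have nd y : y != 0 -> exists x, chi (y * x) != 1.
  move=> y0; apply/existsP; apply: contraNT y0 => /existsPn yP.
  suff /setP/(_ y) : [set y * x | x : R] = [set 0].
    by rewrite !inE => <-; apply/imsetP; exists 1; rewrite ?mulr1.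
  apply: nor; last first.
    by apply/subsetP => _ /imsetP[x _ ->]; rewrite inE; apply/negPn.
  split=> [|_ _ /imsetP[x _ ->] /imsetP[z _ ->]|a _ /imsetP[x _ ->]].
  - by apply/imsetP; exists 0; rewrite ?mulr0.
  - by apply/imsetP; exists (x + z); rewrite ?mulrDr.
  by apply/imsetP; exists (x * a); rewrite ?mulrA.
split=> // x; apply: (@pairing_nondegr _ _ (fun x y => chi (y * x))) => //= *.
- exact: frob_neq0.
- by rewrite mulrDr frobD.
- by rewrite mulrDl frobD.
Qed.

Lemma frob_inj a b : (forall x, chi (a * x) = chi (b * x)) -> a = b.
Proof.
move=> ab; apply/eqP; rewrite -subr_eq0; apply: contraT => /(frob_nondeg.2)[x].
by rewrite mulrBl frobD frobN ab divff ?frob_neq0 ?eqxx.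
Qed.

(* chi (x * w) = chi (nu w * x) for a multiplicative bijection nu of R. *)
Lemma frob_sum_units x :
  \sum_(u in units_of R) chi (u * x) = \sum_(u in units_of R) chi (x * u).
Proof.
have /fin_all_exists[nu nuE] : forall w, exists z, forall x, chi (z * x) = chi (x * w).
  move=> w; apply: (@pairing_repr _ _ (fun x y => chi (x * y))) => [*|*|*|||*].
  - exact: frob_neq0.
  - by rewrite mulrDl frobD.
  - by rewrite mulrDr frobD.
  - exact: frob_nondeg.1.
  - by move=> y z; rewrite mulrDl frobD.
  - exact: frob_neq0.
have nuM v w : nu v * nu w = nu (v * w).
  by apply: frob_inj => y; rewrite -mulrA !nuE -!mulrA nuE mulrA.
have nu1 : nu 1 = 1 by apply: frob_inj => y; rewrite nuE mulr1 mul1r.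
have nu_inj : injective nu.
  move=> v w vw; apply/eqP; rewrite -subr_eq0; apply: contraT.
  move=> /(frob_nondeg.1)[y].
  by rewrite mulrBr frobD frobN -(nuE v) -(nuE w) vw divff ?frob_neq0 ?eqxx.
have nuU u : u \is a GRing.unit -> nu u \is a GRing.unit.
  by move=> uU; apply/unitrP; exists (nu u^-1); rewrite !nuM mulVr ?mulrV.
have imU : nu @: units_of R = units_of R.
  apply/eqP; rewrite eqEcard card_imset // leqnn andbT.
  by apply/subsetP => _ /imsetP[u + ->]; rewrite !inE; apply: nuU.
rewrite -[in LHS]imU big_imset /=; last by move=> ? ? _ _; apply: nu_inj.
by apply: eq_bigr => u _; rewrite nuE.
Qed.

Lemma units_of_gt0 : 0 < #|units_of R|%:R :> F.
Proof. by rewrite ltr0n; apply/card_gt0P; exists 1; rewrite inE unitr1. Qed.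

(** Conjugation sends [chi (u * x)] to [chi (- u * x)] and [-1] permutes the units, so the unit sum
    is real. It is at most the number of units because [chi] has absolute value 1. *)
Lemma whom_ge0 x : 0 <= whom chi x.
Proof.
have U0 := units_of_gt0; have U0' := lt0r_neq0 U0.
have realS : \sum_(u in units_of R) chi (u * x) \is Num.real.
  rewrite CrealE rmorph_sum /=; apply/eqP.
  rewrite [RHS](reindex_inj oppr_inj) /=; apply: eq_big => [u|u _].
    by rewrite !inE unitrN.
  rewrite mulNr frobN; apply: (mulfI (frob_neq0 (u * x))).
  by rewrite -normCK frob_norm expr1n divff ?frob_neq0.
rewrite subr_ge0 ler_pdivrMl // mulr1; apply: le_trans (real_ler_norm realS) _.
apply: le_trans (ler_norm_sum _ _ _) _.
by rewrite (eq_bigr (fun=> 1)) ?sumr_const // => u _; rewrite frob_norm.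
Qed.

Lemma whom_unitl v x : v \is a GRing.unit -> whom chi (v * x) = whom chi x.
Proof.
move=> vU; rewrite /whom; congr (1 - _ * _).
rewrite [RHS](reindex_inj (mulIr vU)) /=; apply: eq_big => [u|u _].
  by rewrite !inE unitrMl.
by rewrite mulrA.
Qed.

Lemma whomv_unitl m n v (x : 'M[R]_(m, n)) :
  v \is a GRing.unit -> whomv chi (v *: x) = whomv chi x.
Proof.
by move=> vU; do 2!apply: eq_bigr => ? _; rewrite mxE whom_unitl.
Qed.

Lemma whomv_ge0 m n (x : 'M[R]_(m, n)) : 0 <= whomv chi x.
Proof. by do 2!apply: sumr_ge0 => ? _; apply: whom_ge0. Qed.

(** This form shows the invariance of the weight under right multiplication by units, needed for the
    right orbits of columns. *)
Lemma whom_right x :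
  whom chi x = 1 - #|units_of R|%:R^-1 * \sum_(u in units_of R) chi (x * u).
Proof. by rewrite /whom frob_sum_units. Qed.

Lemma whom0 : whom chi 0 = 0.
Proof.
rewrite /whom (eq_bigr (fun=> 1)) => [|u _]; last by rewrite mulr0 frob0.
by rewrite sumr_const mulVf ?subrr // lt0r_neq0 ?units_of_gt0.
Qed.

Lemma whomv0 m n : whomv chi (0 : 'M[R]_(m, n)) = 0.
Proof. by rewrite /whomv big1 // => i _; rewrite big1 // => j _; rewrite mxE whom0. Qed.

End FrobeniusCharacter.

(** * Codes *)

Lemma rscale_inj (R : finUnitRingType) m n (u : R) :
  u \is a GRing.unit -> injective (fun g : 'M[R]_(m, n) => rscale g u).
Proof. by move=> uU g h /(congr1 (fun a => rscale a u^-1)); rewrite !rscaleA mulrV ?rscale1. Qed.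

Lemma right_orbitE (R : finUnitRingType) k (g : 'cV[R]_k) :
  right_orbit g = [set h | right_cyclic h == right_cyclic g].
Proof. by apply/setP => h; rewrite inE right_cyclic_eqE. Qed.

Lemma right_cyclic_unit (R : finUnitRingType) k (g : 'cV[R]_k) u :
  u \is a GRing.unit -> right_cyclic (rscale g u) = right_cyclic g.
Proof.
by move=> uU; apply/eqP; rewrite right_cyclic_eqE; apply/imsetP; exists u; rewrite ?inE.
Qed.

Lemma col_mult_unit (R : finUnitRingType) k n (G : 'M[R]_(k, n)) g u :
  u \is a GRing.unit -> col_mult G (rscale g u) = col_mult G g.
Proof. by move=> uU; rewrite /col_mult right_cyclic_unit. Qed.

(** Each term is replaced by its average over the right orbit of the column, on which [f] is
    constant. After exchanging sums, [g] carries the coefficient [col_mult G g / #|right_orbit g|],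
    which modularity makes 0 or [r]. *)
Lemma modular_sum (F : numFieldType) (R : finUnitRingType) k n
    (G : 'M[R]_(k, n)) (r : rat) (f : 'cV[R]_k -> F) :
    (forall j, col j G != 0) ->
    (forall g, g != 0 -> col_mult G g = 0%N \/
       (col_mult G g)%:R = r * #|right_orbit g|%:R :> rat) ->
    (forall u g, u \is a GRing.unit -> f (rscale g u) = f g) ->
  \sum_j f (col j G) = ratr r * \sum_(g | col_mult G g != 0%N) f g.
Proof.
move=> G_neq0 G_mod fU.
have orbit_neq0 (g : 'cV[R]_k) : #|right_orbit g|%:R != 0 :> F.
  rewrite pnatr_eq0 -lt0n; apply/card_gt0P; exists (rscale g 1).
  by apply/imsetP; exists 1; rewrite ?inE ?unitr1.
transitivity (\sum_j \sum_(g | right_cyclic (col j G) == right_cyclic g)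
                f g / #|right_orbit g|%:R).
  apply: eq_bigr => j _.
  transitivity (\sum_(g in right_orbit (col j G))
                  f (col j G) / #|right_orbit (col j G)|%:R).
    by rewrite sumr_const -[RHS]mulr_natr divfK.
  rewrite right_orbitE; apply: eq_big => [g|g]; first by rewrite inE eq_sym.
  rewrite inE => cg; have := cg; rewrite right_cyclic_eqE.
  case/imsetP=> u; rewrite inE => uU gE; rewrite {1}gE fU //.
  by rewrite -right_orbitE !right_orbitE (eqP cg).
rewrite (exchange_big_dep predT) //= mulr_sumr [RHS]big_mkcond /=.
apply: eq_bigr => g _; rewrite sumr_const -[#|_|]/(#|_|).
have -> : #|(fun j => right_cyclic (col j G) == right_cyclic g)| = col_mult G g.
  by rewrite /col_mult cardsE.
have [->|g_mult] := eqVneq (col_mult G g) 0%N; first by rewrite mulr0n.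
have g0 : g != 0.
  apply: contraNneq g_mult => ->; rewrite cards_eq0; apply/eqP/setP => j.
  rewrite !inE right_cyclic_eqE; apply/imsetP => -[u _ /matrixP colE].
  by case/negP: (G_neq0 j); apply/eqP/matrixP => i i'; rewrite colE !mxE mul0r.
have [/eqP|/(congr1 (@ratr F))] := G_mod g g0; first by rewrite (negPf g_mult).
rewrite ratr_nat rmorphM /= ratr_nat => multE; rewrite -[LHS]mulr_natl multE.
by rewrite -mulrA; congr (_ * _); rewrite mulrC divfK.
Qed.

(** * Character sums and weights on codes *)

Section CodeWeights.
Variables (F : numClosedFieldType) (R : finUnitRingType) (chi : R -> F).
Hypothesis chi_frob : frobenius_character chi.

Let chiD := frobD chi_frob.

Lemma frobv_suml k (z : 'cV[R]_k) :
  \sum_(x : 'rV[R]_k) chi ((x *m z) 0 0) = #|{: 'rV[R]_k}|%:R * (z == 0)%:R.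
Proof.
have [->|z0] := eqVneq.
  under eq_bigr do rewrite mulmx0 mxE (frob0 chi_frob).
  by rewrite sumr_const mulr1.
rewrite mulr0; apply: char_sum_eq0 => [x y|]; first by rewrite mulmxDl mxE chiD.
have /cV0Pn[i /(frob_nondeg chi_frob).1[a az]] := z0.
by exists (a *: delta_mx 0 i); rewrite -scalemxAl -rowE !mxE.
Qed.

Lemma frobv_nondegr k (x : 'rV[R]_k) :
  x != 0 -> exists z : 'cV[R]_k, chi ((x *m z) 0 0) != 1.
Proof.
move=> /rV0Pn[i /(frob_nondeg chi_frob).2[a xa]].
by exists (rscale (delta_mx i 0) a); rewrite mulmx_rscale -colE !mxE.
Qed.

(** Scaling by a unit permutes [A], so averaging over the units leaves the character sum over [A]
    unchanged. *)
Lemma sum_whom_rows k (A : {set 'rV[R]_k}) (y : 'cV[R]_k) :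
    (forall u, u \is a GRing.unit -> {in A, forall x, u *: x \in A}) ->
  \sum_(x in A) whom chi ((x *m y) 0 0) =
    #|A|%:R - \sum_(x in A) chi ((x *m y) 0 0).
Proof.
move=> AU; rewrite sumrB sumr_const; congr (_ - _).
rewrite -mulr_sumr exchange_big /=.
rewrite (eq_bigr (fun=> \sum_(x in A) chi ((x *m y) 0 0))) => [|u].
  by rewrite sumr_const -[X in _^-1 * X]mulr_natl mulKf // lt0r_neq0 ?units_of_gt0.
rewrite inE => uU; have u_inj : injective (fun x : 'rV[R]_k => u *: x).
  by move=> v w /(congr1 ( *:%R u^-1)); rewrite !scalerA mulVr // !scale1r.
rewrite [RHS](reindex_inj u_inj) /=.
apply: eq_big => [x|x _]; last by rewrite -scalemxAl [in RHS]mxE.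
apply/idP/idP => [xA|uxA]; first exact: AU.
by rewrite -[x]scale1r -(mulVr uU) -scalerA AU ?unitrV.
Qed.

Lemma sum_whom_cols k (A : {set 'cV[R]_k}) (x : 'rV[R]_k) :
    (forall u, u \is a GRing.unit -> {in A, forall y, rscale y u \in A}) ->
  \sum_(y in A) whom chi ((x *m y) 0 0) =
    #|A|%:R - \sum_(y in A) chi ((x *m y) 0 0).
Proof.
move=> AU; rewrite (eq_bigr _ (fun y _ => whom_right chi_frob _)).
rewrite sumrB sumr_const; congr (_ - _).
rewrite -mulr_sumr exchange_big /=.
rewrite (eq_bigr (fun=> \sum_(y in A) chi ((x *m y) 0 0))) => [|u].
  by rewrite sumr_const -[X in _^-1 * X]mulr_natl mulKf // lt0r_neq0 ?units_of_gt0.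
rewrite inE => uU; rewrite [RHS](reindex_inj (rscale_inj uU)) /=.
apply: eq_big => [y|y _]; last by rewrite mulmx_rscale [in RHS]mxE.
apply/idP/idP => [yA|yuA]; first exact: AU.
by rewrite -[y]rscale1 -(mulrV uU) -rscaleA AU ?unitrV.
Qed.

(** The set Omega: it contains all generators of the points that occur, so it is a union of right
    unit orbits and not merely the set of columns. *)
Definition points_support k n (G : 'M[R]_(k, n)) : {set 'cV[R]_k} :=
  [set g | col_mult G g != 0%N].

Lemma mem_col_support k n (G : 'M[R]_(k, n)) j : col j G \in points_support G.
Proof. by rewrite inE cards_eq0; apply/set0Pn; exists j; rewrite inE. Qed.

Lemma points_supportU k n (G : 'M[R]_(k, n)) u : u \is a GRing.unit ->
  {in points_support G, forall y, rscale y u \in points_support G}.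
Proof. by move=> uU y; rewrite !inE col_mult_unit. Qed.

Lemma points_supportP k n (G : 'M[R]_(k, n)) g : g \in points_support G ->
  exists j, exists2 u, u \is a GRing.unit & g = rscale (col j G) u.
Proof.
rewrite inE cards_eq0 => /set0Pn[j]; rewrite inE eq_sym right_cyclic_eqE.
by case/imsetP=> u; rewrite inE => uU ->; exists j, u.
Qed.

Lemma whomv_mulmx k n (G : 'M[R]_(k, n)) (x : 'rV[R]_k) :
  whomv chi (x *m G) = \sum_j whom chi ((x *m col j G) 0 0).
Proof.
rewrite /whomv big_ord1; apply: eq_bigr => j _.
by rewrite !mxE; congr (whom chi _); apply: eq_bigr => l _; rewrite mxE.
Qed.

(** * Fourier analysis on the code of a modular matrix *)

Section ModularGenerator.
Variables (k n : nat) (G : 'M[R]_(k, n)) (r : rat).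
Hypothesis G_neq0 : forall j, col j G != 0.
Hypothesis G_mod : forall g, g != 0 -> col_mult G g = 0%N \/
  (col_mult G g)%:R = r * #|right_orbit g|%:R :> rat.

Local Notation Omega := (points_support G).

Lemma modular_length : n%:R = ratr r * #|Omega|%:R :> F.
Proof.
have := @modular_sum F R k n G r (fun=> 1) G_neq0 G_mod (fun _ _ _ => erefl).
by rewrite sumr_const card_ord sumr_const /= => ->; rewrite cardsE.
Qed.

(** [modular_sum] turns the weight into a sum over Omega, where the average over units is absorbed
    by the unit invariance of Omega. *)
Lemma whomv_modular (x : 'rV[R]_k) : whomv chi (x *m G) =
  n%:R - ratr r * \sum_(h in Omega) chi ((x *m h) 0 0).
Proof.
rewrite whomv_mulmx.
rewrite (@modular_sum _ _ _ _ G r (fun g => whom chi ((x *m g) 0 0))) //; last first.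
  move=> u g uU; rewrite mulmx_rscale mxE !whom_right //; congr (_ - _ * _).
  rewrite [RHS](reindex_inj (mulrI uU)); apply: eq_big => [v|v _]; last by rewrite mulrA.
  by rewrite !inE unitrMr.
rewrite modular_length -mulrBr -sum_whom_cols; last exact: points_supportU.
by congr (_ * _); apply: eq_bigl => g; rewrite inE.
Qed.

(** The fibres of [x |-> x *m G] are cosets of its kernel. This transfers sums over all coefficient
    vectors, where orthogonality is available, to sums over codewords. *)
Lemma sum_row_space (f : 'rV[R]_n -> F) :
  \sum_x f (x *m G) =
    #|[set x : 'rV[R]_k | x *m G == 0]|%:R * \sum_(c in left_row_space G) f c.
Proof.
rewrite (partition_big (mulmx^~ G) (mem (left_row_space G))) /=; last first.
  by move=> x _; apply/imsetP; exists x.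
rewrite mulr_sumr; apply: eq_bigr => c /imsetP[x0 _ ->].
rewrite (eq_bigr (fun=> f (x0 *m G))) => [|x /eqP->//].
rewrite sumr_const mulr_natl; congr (_ *+ _).
rewrite -[RHS](card_imset _ (addIr x0)); apply: eq_card => x.
rewrite -[x \in _]/(x *m G == x0 *m G); apply/eqP/imsetP => [xG|[z + ->]].
  by exists (x - x0); rewrite ?subrK // inE mulmxBl xG subrr.
by rewrite inE => /eqP zG; rewrite mulmxDl zG add0r.
Qed.

Lemma card_ker_neq0 : #|[set x : 'rV[R]_k | x *m G == 0]|%:R != 0 :> F.
Proof.
by rewrite pnatr_eq0 -lt0n; apply/card_gt0P; exists 0; rewrite inE mul0mx.
Qed.

Lemma card_row_space :
  #|{: 'rV[R]_k}|%:R =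
    #|[set x : 'rV[R]_k | x *m G == 0]|%:R * #|left_row_space G|%:R :> F.
Proof. by have := sum_row_space (fun=> 1); rewrite !sumr_const. Qed.

Lemma row_space_char_sum (y : 'cV[R]_n) :
  \sum_(c in left_row_space G) chi ((c *m y) 0 0) =
    #|left_row_space G|%:R * (G *m y == 0)%:R.
Proof.
apply: (mulfI card_ker_neq0); rewrite -sum_row_space mulrA -card_row_space.
by rewrite -frobv_suml; apply: eq_bigr => x _; rewrite mulmxA.
Qed.

(** The Fourier transform of the weight: after inserting [whomv_modular], orthogonality keeps only
    [G *m y = 0] from the constant term and [h = - (G *m y)] from the sum over Omega. *)
Lemma row_space_whom_char_sum (y : 'cV[R]_n) :
  \sum_(c in left_row_space G) whomv chi c * chi ((c *m y) 0 0) =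
    #|left_row_space G|%:R *
      (n%:R * (G *m y == 0)%:R - ratr r * (G *m y \in Omega)%:R).
Proof.
apply: (mulfI card_ker_neq0); rewrite -sum_row_space mulrA -card_row_space.
transitivity (\sum_(x : 'rV[R]_k) (n%:R * chi ((x *m (G *m y)) 0 0) -
    ratr r * \sum_(h in Omega) chi ((x *m (h + G *m y)) 0 0))).
  apply: eq_bigr => x _; rewrite whomv_modular mulrBl -mulmxA; congr (_ - _).
  rewrite -mulrA mulr_suml; congr (_ * _); apply: eq_bigr => h _.
  by rewrite mulmxDr [in RHS]mxE chiD.
rewrite sumrB -!mulr_sumr frobv_suml exchange_big /= mulrBr mulrCA; congr (_ - _).
under eq_bigr do rewrite frobv_suml.
rewrite -mulr_sumr mulrCA; congr (_ * (_ * _)).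
(* Since [-1] is a unit, Omega is symmetric, which removes the sign of the surviving [h]. *)
have Omega_opp h : (- h \in Omega) = (h \in Omega).
  have N1 (g : 'cV[R]_k) : - g = rscale g (-1).
    by apply/matrixP => i j; rewrite !mxE mulrN1.
  by rewrite N1 !inE col_mult_unit ?unitrN1.
rewrite -Omega_opp; case: (boolP (_ \in Omega)) => GyO.
  rewrite (bigD1 (- (G *m y))) //= addNr eqxx big1 ?addr0 // => h /andP[_].
  by rewrite addr_eq0 => /negPf->.
rewrite big1 // => h hO; rewrite addr_eq0; case: eqP => // hG.
by rewrite -hG hO in GyO.
Qed.

End ModularGenerator.
End CodeWeights.

(** * Matrices whose rows list a set *)

Section RowListing.
Variables (R : finUnitRingType) (b n : nat) (M : 'M[R]_(b, n)) (A : {set 'rV[R]_n}).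
Hypothesis M_A : row_listing M A.

Lemma mem_row_listing i : row i M \in A.
Proof. by rewrite -mem_enum -(perm_mem M_A); apply/mapP; exists i; rewrite ?mem_enum. Qed.

Lemma row_listing_big (V : Type) (idx : V) (op : Monoid.com_law idx)
    (f : 'rV[R]_n -> V) :
  \big[op/idx]_i f (row i M) = \big[op/idx]_(c in A) f c.
Proof. by rewrite -[RHS]big_enum -(perm_big _ M_A) big_map big_enum. Qed.

Lemma row_mult_listing (g : 'rV[R]_n) : row_mult M g = #|A :&: left_orbit g|.
Proof.
rewrite /row_mult -!sum1_card big_mkcond [RHS](eq_bigl _ _ (fun c => in_setI c A _)).
rewrite [RHS]big_mkcondr -row_listing_big; apply: eq_bigr => i _.
by rewrite inE left_cyclic_eqE.
Qed.

(** As [A] is closed under left units, a left orbit is either disjoint from [A] or contained in it;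
    each row being listed once, the multiplicity is 0 or the full orbit size, whence index 1. *)
Lemma row_listing_modular :
    (forall u, u \is a GRing.unit -> {in A, forall c, u *: c \in A}) ->
    0 \notin A ->
  right_modular (right_col_space M) 1.
Proof.
move=> AU A0; split=> [i|].
  have /rV0Pn[j Mij] : row i M != 0 by apply: contraNneq A0 => <-; exact: mem_row_listing.
  exists (M *m delta_mx j 0); first by apply/imsetP; exists (delta_mx j 0).
  by rewrite -colE; rewrite !mxE in Mij *.
exists n, M; split=> // g _; rewrite mul1r row_mult_listing.
have [->|[c]] := set_0Vmem (A :&: left_orbit g); first by left; rewrite cards0.
rewrite inE => /andP[cA /imsetP[u]]; rewrite inE => uU cE; right.
congr (#|pred_of_set _|%:R); apply/setIidPr/subsetP => _ /imsetP[v + ->].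
rewrite inE => vU; have -> : v *: g = (v / u) *: c by rewrite cE scalerA divrK.
by rewrite AU // unitrMl ?unitrV.
Qed.

End RowListing.

Lemma right_col_space_linear (R : finUnitRingType) m n (M : 'M[R]_(m, n)) :
  right_linear (right_col_space M).
Proof.
split=> [|_ _ /imsetP[x _ ->] /imsetP[y _ ->]|a _ /imsetP[x _ ->]].
- by apply/imsetP; exists 0; rewrite ?mulmx0.
- by apply/imsetP; exists (x + y); rewrite ?mulmxDr.
by apply/imsetP; exists (rscale x a); rewrite ?mulmx_rscale.
Qed.

(** * Weights of the dual code *)

Lemma two_weight_dual (F : numClosedFieldType) (R : finUnitRingType)
    (chi : R -> F) (hchi : frobenius_character chi)
    (n : nat) (hn : (0 < n)%N)
    (C : {set 'rV[R]_n}) (r : rat) (hmod : left_modular C r)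
    (w1 w2 : F) (hw : w1 < w2) (htw : two_weights chi C w1 w2)
    (hC0 : [set c in C | whomv chi c == 0] = [set 0])
    (b1 : nat) (hb1 : b1 = #|[set c in C | whomv chi c == w1]|)
    (M1 : 'M[R]_(b1, n))
    (hM1 : row_listing M1 [set c in C | whomv chi c == w1]) :
  let C' := right_col_space M1 in
  let w1' := (w2 - n%:R - ratr r) * #|C|%:R / (w2 - w1) in
  let w2' := (w2 - n%:R) * #|C|%:R / (w2 - w1) in
  [/\ right_linear C',
      exists r' : rat, right_modular C' r',
      two_weights chi C' w1' w2',
      [set d in C' | whomv chi d == 0] = [set 0]
    & w1' = b1%:R * w1 / n%:R].
Proof.
move=> C' w1' w2'; set X1 := [set c in C | whomv chi c == w1] in hb1 hM1.
have [[w1_0 w2_0 w12] [c1 c1C wc1] [c2 c2C wc2] wC] := htw.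
have [C_coord [k [G [CE G_mod]]]] := hmod.
have C0 c : c \in C -> (whomv chi c == 0) = (c == 0).
  by move=> cC; move/setP/(_ c): hC0; rewrite !inE cC.
have G_neq0 j : col j G != 0.
  have [c] := C_coord j; rewrite CE => /imsetP[x _ ->]; apply: contraNneq => G0.
  have /matrixP/(_ 0 0) : x *m col j G = 0 by rewrite G0 mulmx0.
  by rewrite !mxE => {2}<-; apply/eqP/eq_bigr => l _; rewrite !mxE.
set Om := points_support G.
have Om0 : 0 \notin Om.
  apply/negP => /points_supportP[j [u uU G0]]; case/eqP: (G_neq0 j).
  by apply: (rscale_inj uU); rewrite -G0; apply/matrixP => i l; rewrite !mxE mul0r.
have w1_gt0 : 0 < w1 by rewrite lt_def w1_0 -wc1 whomv_ge0.
have dw : w2 - w1 != 0 by rewrite subr_eq0 eq_sym.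
have X1U u : u \is a GRing.unit -> {in X1, forall c, u *: c \in X1}.
  move=> uU c; rewrite !inE whomv_unitl // => /andP[cC ->]; rewrite andbT.
  move: cC; rewrite CE => /imsetP[x _ ->].
  by apply/imsetP; exists (u *: x); rewrite ?scalemxAl.
have X1_0 : 0 \notin X1 by rewrite inE whomv0 // eq_sym (negPf w1_0) andbF.
(* On [C] the indicator of [X1] times [w2 - w1] is [w2] minus the weight minus [w2] times the
   indicator of 0; the three terms are transformed separately. *)
have fourier y : (w2 - w1) * \sum_(c in X1) chi ((c *m y) 0 0) =
    #|C|%:R * ((w2 - n%:R) * (G *m y == 0)%:R + ratr r * (G *m y \in Om)%:R) - w2.
  transitivity (\sum_(c in C) (w2 * chi ((c *m y) 0 0)
      - whomv chi c * chi ((c *m y) 0 0) - (c == 0)%:R * w2)).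
    rewrite mulr_sumr (eq_bigl (fun c => (c \in C) && (whomv chi c == w1)));
      last by move=> c; rewrite inE.
    rewrite big_mkcondr; apply: eq_bigr => c cC; rewrite -C0 //.
    case: (wC c cC) => wc; rewrite wc.
    - have /eqP-> : c == 0 by rewrite -C0 // wc.
      rewrite eqxx eq_sym (negPf w1_0) mul0mx mxE frob0 //.
      by rewrite mulr1 mul0r mul1r subr0 subrr.
    - by rewrite eqxx (negPf w1_0) mul0r subr0 mulrBl.
    by rewrite eq_sym (negPf w12) (negPf w2_0) mul0r subr0 subrr.
  rewrite !sumrB -mulr_sumr CE row_space_char_sum //.
  rewrite (row_space_whom_char_sum hchi G_neq0 G_mod) (bigD1 0) /=; last first.
    by apply/imsetP; exists 0; rewrite ?mul0mx.
  rewrite big1 => [|c /andP[_ /negPf->]]; last by rewrite mul0r.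
  rewrite eqxx mul1r -/Om.
  move: (#|_|%:R) (G *m y == 0)%:R (G *m y \in Om)%:R (ratr r) => N z o s.
  by ring.
(* At [y = 0] the character sum just counts [X1]. Subtracting [fourier] from this below cancels the
   stray [- w2]. *)
have b1E : (w2 - w1) * b1%:R = #|C|%:R * (w2 - n%:R) - w2.
  have := fourier 0; rewrite mulmx0 eqxx (negPf Om0) mulr0 addr0 mulr1 => <-.
  congr (_ * _); rewrite (eq_bigr (fun=> 1)) ?sumr_const ?hb1 // => c _.
  by rewrite mulmx0 mxE frob0.
have wdual y : whomv chi (M1 *m y) =
    #|C|%:R * (w2 - n%:R - (w2 - n%:R) * (G *m y == 0)%:R
               - ratr r * (G *m y \in Om)%:R) / (w2 - w1).
  apply: (mulfI dw); rewrite mulrCA divff // mulr1.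
  transitivity ((w2 - w1) * \sum_(c in X1) whom chi ((c *m y) 0 0)).
    congr (_ * _); rewrite -(row_listing_big hM1) /whomv; apply: eq_bigr => i _.
    by rewrite big_ord1 -row_mul [in RHS]mxE.
  rewrite sum_whom_rows // mulrBr fourier -hb1 b1E.
  by rewrite opprB addrA subrK -mulrBr opprD addrA.
have wdual0 (y : 'cV[R]_n) : G *m y = 0 -> whomv chi (M1 *m y) = 0.
  by move=> Gy; rewrite wdual Gy eqxx (negPf Om0) mulr1 subrr mulr0 subr0 mulr0 mul0r.
have wdual1 (y : 'cV[R]_n) : G *m y \in Om -> whomv chi (M1 *m y) = w1'.
  move=> GyO; have /negPf Gy0 : G *m y != 0 by apply: contraTneq GyO => ->.
  by rewrite wdual GyO Gy0 mulr0 subr0 mulr1 [#|C|%:R * _]mulrC.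
have wdual2 (y : 'cV[R]_n) : G *m y != 0 -> G *m y \notin Om -> whomv chi (M1 *m y) = w2'.
  move=> /negPf Gy0 /negPf Gy; rewrite wdual Gy Gy0 !mulr0 !subr0.
  by rewrite [#|C|%:R * _]mulrC.
have n0 : 0 < n%:R :> F by rewrite ltr0n.
have Om_gt0 : 0 < #|Om|%:R :> F.
  by rewrite ltr0n; apply/card_gt0P; exists (col (Ordinal hn) G); exact: mem_col_support.
(* From [n = r #|Om|] with [n] positive. This sign gives [w1' < w2'], the two numerators differing
   by [r #|C|]. *)
have r_gt0 : 0 < ratr r :> F.
  by rewrite -(pmulr_lgt0 _ Om_gt0) -(modular_length _ G_neq0 G_mod).
have G_delta j : G *m delta_mx j 0 \in Om by rewrite -colE mem_col_support.
have w1'E : w1' = b1%:R * w1 / n%:R.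
  apply: (mulIf (lt0r_neq0 n0)); rewrite divfK ?lt0r_neq0 //.
  transitivity (\sum_j whomv chi (M1 *m (delta_mx j 0 : 'cV_n))).
    by rewrite (eq_bigr _ (fun j _ => wdual1 _ (G_delta j))) sumr_const card_ord mulr_natr.
  (* The total weight of the entries of [M1], counted by columns on one side and by rows on the
     other. *)
  transitivity (\sum_(c in X1) whomv chi c).
    rewrite -(row_listing_big hM1) exchange_big /=; apply: eq_bigr => i _.
    rewrite /whomv big_ord1; apply: eq_bigr => j _.
    by rewrite big_ord1 -colE !mxE.
  rewrite (eq_bigr (fun=> w1)) ?sumr_const -?hb1 ?mulr_natl // => c.
  by rewrite inE => /andP[_ /eqP].
have b1_gt0 : 0 < b1%:R :> F.
  by rewrite ltr0n hb1; apply/card_gt0P; exists c1; rewrite inE c1C wc1 eqxx.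
have w1'_gt0 : 0 < w1' by rewrite w1'E divr_gt0 ?mulr_gt0.
have C_gt0 : 0 < #|C|%:R :> F by rewrite ltr0n; apply/card_gt0P; exists c1.
have w12' : w1' < w2'.
  rewrite ltr_pM2r ?invr_gt0 ?subr_gt0 // ltr_pM2r // ltrBlDr ltrDl //.
have w2'_gt0 := lt_trans w1'_gt0 w12'.
have M1ker (y : 'cV[R]_n) : G *m y = 0 -> M1 *m y = 0.
  move=> Gy; apply/row_matrixP => i; rewrite row_mul row0.
  have := mem_row_listing hM1 i; rewrite inE CE => /andP[/imsetP[x _ ->] _].
  by rewrite -mulmxA Gy mulmx0.
(* Otherwise 0 and [Om] exhaust the column space of [G]. For a nonzero codeword [x *m G] the
   character sum over that space vanishes, so the part over [Om] is [-1] and the weight is always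
   [n + r], contradicting [w1 != w2]. *)
have [y2 Gy2_0 Gy2] : exists2 y : 'cV_n, G *m y != 0 & G *m y \notin Om.
  suff /existsP[y /andP[]] : [exists y : 'cV_n, (G *m y != 0) && (G *m y \notin Om)] by exists y.
  apply: contraT => /existsPn none.
  have imG : right_col_space G = 0 |: Om.
    apply/setP => h; rewrite in_setU1; apply/imsetP/orP => [[y _ ->]|].
      by have := none y; rewrite negb_and !negbK => /orP.
    case=> [/eqP->|/points_supportP[j [u _ ->]]]; first by exists 0; rewrite ?mulmx0.
    by exists (rscale (delta_mx j 0) u); rewrite // mulmx_rscale -colE.
  have wconst c : c \in C -> c != 0 -> whomv chi c = n%:R + ratr r.
    rewrite CE => /imsetP[x _ ->] /(frobv_nondegr hchi)[y xGy].
    suff S : \sum_(h in Om) chi ((x *m h) 0 0) = -1.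
      by rewrite (whomv_modular hchi G_neq0 G_mod) S mulrN1 opprK.
    (* The added 1 is read as the term [h = 0], which completes [Om] to the column space. *)
    apply: (addrI 1); rewrite subrr -[X in X + _](frob0 hchi).
    rewrite -[X in chi X](_ : (x *m (0 : 'cV_k)) 0 0 = 0); last by rewrite mulmx0 mxE.
    rewrite -big_setU1 // -imG; apply: char_sum_in_eq0 => [z z'||].
    - by rewrite mulmxDr mxE frobD.
    - by have [] := right_col_space_linear G.
    by exists (G *m y); [apply/imsetP; exists y | rewrite mulmxA].
  case/eqP: w12; rewrite -wc1 -wc2 !wconst //.
    by apply: contra_neq w2_0 => c20; rewrite -wc2 c20 whomv0.
  by apply: contra_neq w1_0 => c10; rewrite -wc1 c10 whomv0.
split=> //.
- exact: right_col_space_linear.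
- by exists 1; apply: row_listing_modular hM1 X1U X1_0.
- split.
  + by rewrite !lt0r_neq0 // (lt_eqF w12').
  + exists (M1 *m delta_mx (Ordinal hn) 0); last exact: wdual1.
    by apply/imsetP; exists (delta_mx (Ordinal hn) 0).
  + exists (M1 *m y2); last exact: wdual2.
    by apply/imsetP; exists y2.
  move=> _ /imsetP[y _ ->]; have [Gy|Gy] := eqVneq (G *m y) 0.
    by constructor 1; apply: wdual0.
  case: (boolP (G *m y \in Om)) => GyO; first by constructor 2; apply: wdual1.
  by constructor 3; apply: wdual2.
apply/setP => d; rewrite !inE; apply/andP/eqP => [[/imsetP[y _ ->]]|->]; last first.
  by split; [apply/imsetP; exists 0; rewrite ?mulmx0 | rewrite whomv0].
have [Gy _|Gy] := eqVneq (G *m y) 0; first exact: M1ker.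
case: (boolP (G *m y \in Om)) => GyO.
  by rewrite wdual1 // (negPf (lt0r_neq0 w1'_gt0)).
by rewrite wdual2 // (negPf (lt0r_neq0 w2'_gt0)).
Qed.

Theorem theorem15 (K : realType) (R : finUnitRingType) (chi : R -> complex K)
    (hchi : frobenius_character chi)
    (n : nat) (hn : (0 < n)%N)
    (C : {set 'rV[R]_n}) (hC : left_linear C)
    (r : rat) (hmod : left_modular C r)
    (w1 w2 : complex K) (hw : w1 < w2) (htw : two_weights chi C w1 w2)
    (hC0 : [set c in C | whomv chi c == 0] = [set 0])
    (b1 : nat) (hb1 : b1 = #|[set c in C | whomv chi c == w1]|)
    (M1 : 'M[R]_(b1, n))
    (hM1 : row_listing M1 [set c in C | whomv chi c == w1]) :
  let C' := right_col_space M1 in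
  let w1' := (w2 - n%:R - ratr r) * #|C|%:R / (w2 - w1) in
  let w2' := (w2 - n%:R) * #|C|%:R / (w2 - w1) in
  [/\ right_linear C',
      exists r' : rat, right_modular C' r',
      two_weights chi C' w1' w2',
      [set d in C' | whomv chi d == 0] = [set 0]
    & w1' = b1%:R * w1 / n%:R].
Proof. exact: two_weight_dual. Qed.
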